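(* Let $T$ be a tree with $n(T)\ge 3$ vertices and let $k\in\{2,3,\ldots,n(T)-1\}$. Then ${\rm sgp}_k(T)=\ell(T)$ if $k\le \ell(T)$, and ${\rm sgp}_k(T)=k$ if $k>\ell(T)$.
   Context: $n(T)$ is the number of vertices of $T$ and $\ell(T)$ is the number of leaves of $T$. For a nonempty $W\subseteq V(G)$ of a graph $G$, the Steiner distance $d_G(W)$ is the minimum number of edges of a connected subgraph of $G$ containing $W$; such a minimum subgraph is a tree, called a Steiner $W$-tree. For a positive integer $k$, a set $A\subseteq V(G)$ is a $k$-Steiner general position set if for every $B\subseteq A$ with $|B|=k$ and every Steiner $B$-tree $T_B$ we have $V(T_B)\cap A=B$. ${\rm sgp}_k(G)$ is the largest cardinality of a $k$-Steiner general position set of $G$. *)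

(* Defs.v *)
From mathcomp Require Import all_boot.

Set Implicit Arguments.
Unset Strict Implicit.
Unset Printing Implicit Defensive.

(* A finite simple graph is given by a vertex type V : finType and an adjacency
   relation e : rel V, assumed symmetric and irreflexive in the theorem. *)

Section Graphs.

Variables (V : finType) (e : rel V).

Definition connected_graph : Prop := forall x y : V, connect e x y.

(* A cycle has pairwise distinct vertices and length at least 3: when e is
   symmetric, [:: x; y] is a ucycle for every edge xy. *)
Definition acyclic_graph : Prop :=
  forall c : seq V, ucycle e c -> size c <= 2.

Definition tree : Prop := connected_graph /\ acyclic_graph.

Definition degree (x : V) : nat := #|[set y | e x y]|.

Definition leaves : {set V} := [set x | degree x == 1].

Definition edges : {set {set V}} :=
  [set [set p.1; p.2] | p : V * V & e p.1 p.2].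

(* H.1 is the vertex set and H.2 the edge set of a candidate subgraph H. *)
Definition pregraph : finType := ({set V} * {set {set V}})%type.

Definition subgraph (H : pregraph) : bool :=
  (H.2 \subset edges) && (cover H.2 \subset H.1).

Definition subgraph_adj (H : pregraph) : rel V :=
  [rel x y | [set x; y] \in H.2].

Definition connected_subgraph (H : pregraph) : bool :=
  [&& subgraph H, H.1 != set0 &
      [forall x in H.1, forall y in H.1, connect (subgraph_adj H) x y]].

Definition connector (W : {set V}) (H : pregraph) : bool :=
  connected_subgraph H && (W \subset H.1).

(* The default value #|edges| of the minimum bounds the size of every connector,
   so it only matters when no connector of W exists (G disconnected). *)
Definition steiner_distance (W : {set V}) : nat :=
  \big[minn/#|edges|]_(H : pregraph | connector W H) #|H.2|.

Definition steiner_tree (W : {set V}) (H : pregraph) : bool :=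
  connector W H && (#|H.2| == steiner_distance W).

Definition steiner_general_position (k : nat) (A : {set V}) : bool :=
  [forall B : {set V}, (B \subset A) && (#|B| == k) ==>
    [forall H : pregraph, steiner_tree B H ==> (H.1 :&: A == B)]].

Definition sgp (k : nat) : nat :=
  \max_(A : {set V} | steiner_general_position k A) #|A|.

End Graphs.

(* Main.v *)
Require Import Defs.
From mathcomp Require Import all_boot.

(** Leaves give the lower bound for [k <= #|leaves e|]: a leaf of the tree that
    is not a terminal can be deleted from any connector, so Steiner trees avoid
    it.  For the upper bound, let [A] be a [k]-Steiner general position set with
    more than [k] vertices.  If [a] in [A] separated two other vertices [x], [y]
    of [A], a Steiner tree of some [k]-set [B] with [x, y] in [B] and [a] not in
    [B] would contain [a]; hence [A :\ a] lies in one component of the tree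
    minus [a].  So each [a] can be sent to a leaf that is [a] itself or is
    separated by [a] from the rest of [A], and this assignment is injective. *)

Set Implicit Arguments.
Unset Strict Implicit.
Unset Printing Implicit Defensive.

(** * Sets of prescribed size and bounded minima *)

Lemma subset_between (T : finType) (C A : {set T}) k :
    C \subset A -> #|C| <= k <= #|A| ->
  exists B : {set T}, [/\ C \subset B, B \subset A & #|B| = k].
Proof.
move=> sCA /andP[leCk lekA].
have [n nE] : exists n, k = #|C| + n by exists (k - #|C|); rewrite subnKC.
elim: n C sCA leCk nE => [|n IHn] C sCA leCk nE.
  by exists C; split=> //; rewrite nE addn0.
have : C \proper A.
  by rewrite properEcard sCA (leq_trans _ lekA) // nE addnS ltnS leq_addr.
case/properP=> _ [x xA xC].
have cxC : #|x |: C| = #|C|.+1 by rewrite cardsU1 xC.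
have [|||B [sCB sBA cB]] := IHn (x |: C).
- by rewrite subUset sub1set xA.
- by rewrite cxC nE addnS ltnS leq_addr.
- by rewrite cxC nE addnS.
by exists B; split=> //; apply: subset_trans sCB; apply: subsetUr.
Qed.

Lemma bigmin_leq_cond (I : eqType) (r : seq I) (P : pred I) (F : I -> nat) d i :
  i \in r -> P i -> \big[minn/d]_(j <- r | P j) F j <= F i.
Proof.
elim: r => // j r IHr; rewrite inE big_cons => /predU1P[<- ->|ir Pi].
  exact: geq_minl.
by case: ifP => _; rewrite ?geq_min IHr ?orbT.
Qed.

Section Graphs.

Variables (V : finType) (e : rel V).
Hypotheses (e_sym : symmetric e) (e_irr : irreflexive e).

(** * Connectivity after deleting a vertex *)

Definition del_vertex (a u v : V) := [&& e u v, u != a & v != a].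

Lemma del_vertex_sym a : symmetric (del_vertex a).
Proof. by move=> u v; rewrite /del_vertex e_sym [(u != a) && _]andbC. Qed.

Lemma connect_del_sym a : connect_sym (del_vertex a).
Proof. exact/sym_connect_sym/del_vertex_sym. Qed.

Lemma path_del_vertex a x p :
  a \notin x :: p -> path e x p -> path (del_vertex a) x p.
Proof.
elim: p x => //= y p IHp x; rewrite inE negb_or => /andP[ax ayp] /andP[exy pyp].
rewrite IHp // /del_vertex exy [x == a]eq_sym ax [y == a]eq_sym /= andbT.
by move: ayp; rewrite inE negb_or => /andP[].
Qed.

Lemma connect_del a x p :
  a \notin x :: p -> path e x p -> connect (del_vertex a) x (last x p).
Proof. by move=> ap pp; apply/connectP; exists p; rewrite ?path_del_vertex. Qed.

(** The pair may come from [(x, y)] or from [(y, x)], which symmetry identifies; irreflexivity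
    excludes loops, so an edge has two distinct ends. *)
Lemma mem_edges x y : ([set x; y] \in edges e) = e x y.
Proof.
apply/imsetP/idP => [[[u v] uv E]|exy]; last by exists (x, y); rewrite ?inE.
rewrite inE /= in uv.
have xE : x \in [set u; v] by rewrite -E set21.
have yE : y \in [set u; v] by rewrite -E set22.
have uE : u \in [set x; y] by rewrite E set21.
have vE : v \in [set x; y] by rewrite E set22.
have nuv : u != v by apply: contraTneq uv => ->; rewrite e_irr.
move: uv nuv; case/set2P: xE => xE; case/set2P: yE => yE;
  rewrite ?xE ?yE // ?[e v u]e_sym // => uv.
- by move: vE; rewrite xE yE setUid inE eq_sym => ->.
- by move: uE; rewrite xE yE setUid inE => ->.
Qed.

Lemma subgraph_adjP H u v : subgraph e H -> subgraph_adj H u v ->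
  [/\ e u v, u \in H.1 & v \in H.1].
Proof.
case/andP=> /subsetP sE /subsetP sV uvH; split.
- by rewrite -mem_edges; apply: sE.
- by apply: sV; apply/bigcupP; exists [set u; v]; rewrite ?set21.
- by apply: sV; apply/bigcupP; exists [set u; v]; rewrite ?set22.
Qed.

Lemma connected_subgraph_avoid H a x y :
    connected_subgraph e H -> a \notin H.1 -> x \in H.1 -> y \in H.1 ->
  connect (del_vertex a) x y.
Proof.
case/and3P=> sH _ /'forall_implyP cH aH xH yH.
move/forall_inP: (cH x xH) => /(_ y yH).
apply: connect_sub => u v uv; apply: connect1.
have [euv uH vH] := subgraph_adjP sH uv.
by rewrite /del_vertex euv !(contraNneq _ aH) // => <-.
Qed.

(** * Leaves in Steiner trees, and the lower bounds *)

Lemma steiner_distance_le W H :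
  connector e W H -> steiner_distance e W <= #|H.2|.
Proof.
by move=> cH; apply: bigmin_leq_cond; rewrite ?mem_index_enum.
Qed.

(** An inner vertex of a simple path has a predecessor and a successor that differ, whereas a leaf
    has a single neighbour. *)
Lemma leaf_not_inner v x p : v \in leaves e -> path e x p -> uniq (x :: p) ->
  v != x -> v != last x p -> v \notin p.
Proof.
rewrite inE => /cards1P[w wE] pp up vx vl; apply/negP => vp.
have nbrE y : e v y -> y = w by move=> vy; apply/set1P; rewrite -wE inE.
case/splitPr: vp pp up vl => p1 [|y p2]; rewrite last_cat /= ?eqxx //.
rewrite cat_path /= => /and4P[_ ev vy _] up _.
have : uniq ((x :: p1) ++ [:: v, y & p2]) by [].
rewrite cat_uniq => /and3P[_ /hasPn yp1 _].
have /negP[] : y \notin x :: p1 by apply: yp1; rewrite !inE eqxx orbT.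
by rewrite (nbrE _ vy) -(nbrE (last x p1)) ?mem_last // e_sym.
Qed.

(** Otherwise deleting [v] with its edges leaves a smaller connector, since simple paths between
    other vertices do not pass through a leaf. A terminal in [B] is a vertex of [H] other than [v],
    so [v] has an edge to lose. *)
Lemma steiner_tree_leaf B H v : B != set0 -> steiner_tree e B H ->
  v \in leaves e -> v \in H.1 -> v \in B.
Proof.
move=> /set0Pn[b bB] /andP[cH /eqP HE] vL vH; apply/negPn/negP => vB.
case/andP: (cH) => /and3P[sH _ /'forall_implyP coH] /subsetP sBH.
pose H' : pregraph V := (H.1 :\ v, [set E in H.2 | v \notin E]).
have sH' : H'.2 \subset H.2 by apply/subsetP => E; rewrite inE => /andP[].
have bv : b != v by apply: contraNneq vB => <-.
have adjH' x y : subgraph_adj H x y -> v != x -> v != y -> subgraph_adj H' x y.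
  by move=> xy vx vy; rewrite /subgraph_adj /= !inE [_ \in _]xy negb_or vx vy.
have cH' : connector e B H'.
  apply/andP; split; last first.
    apply/subsetP => y yB; rewrite !inE sBH // andbT.
    by apply: contraNneq vB => <-.
  apply/and3P; split.
  - case/andP: sH => sE sV; apply/andP; split; first exact: subset_trans sE.
    apply/subsetP => y /bigcupP[E]; rewrite inE => /andP[EH vE] yE.
    rewrite !inE (contraNneq _ vE) => [|<-] //=.
    by apply: (subsetP sV); apply/bigcupP; exists E.
  - by apply/set0Pn; exists b; rewrite !inE bv sBH.
  apply/forall_inP => x; rewrite !inE => /andP[xv xH].
  apply/forall_inP => y; rewrite !inE => /andP[yv yH].
  have /connectP[p0 p0P yE] : connect (subgraph_adj H) x y.
    by move/forall_inP: (coH x xH); apply.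
  case/shortenP: p0P yE => p pp up _ yE.
  have vp : v \notin p.
    apply: (leaf_not_inner vL _ up); rewrite -?yE 1?eq_sym //.
    by apply: sub_path pp => s t /(subgraph_adjP sH)[].
  apply/connectP; exists p => //.
  have {xv} : v \notin x :: p by rewrite inE negb_or eq_sym xv.
  elim: p x pp {up xH yE vp} => //= z p IHp x /andP[xz pp].
  rewrite inE negb_or => /andP[vx vzp]; rewrite IHp // andbT adjH' //.
  by move: vzp; rewrite inE negb_or => /andP[].
have : #|H'.2| < #|H.2|.
  apply: proper_card; rewrite properE sH' /=; apply/subsetPn.
  have /connectP[[|z p] /=] : connect (subgraph_adj H) v b.
    by move/forall_inP: (coH v vH) => /(_ b); apply; apply: sBH.
    by move=> _ bE; rewrite bE eqxx in bv.
  by case/andP=> vz _ _; exists [set v; z]; rewrite // !inE eqxx andbF.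
by rewrite ltnNge HE steiner_distance_le.
Qed.

Lemma sgp_leaves k : 0 < k -> steiner_general_position e k (leaves e).
Proof.
move=> k0; apply/forallP => B; apply/implyP => /andP[sBL /eqP cB].
apply/forall_inP => H stH; rewrite eqEsubset; apply/andP; split; last first.
  by rewrite subsetI sBL andbT; case/andP: stH => /andP[].
apply/subsetP => v /setIP[vH vL]; apply: steiner_tree_leaf stH vL vH.
by rewrite -card_gt0 cB.
Qed.

(** The only subset of [A] with [#|A|] elements is [A]. This supplies the lower bound when [k]
    exceeds the number of leaves. *)
Lemma sgp_card_eq (A : {set V}) : steiner_general_position e #|A| A.
Proof.
apply/forallP => B; apply/implyP => /andP[sBA /eqP cB].
have -> : B = A by apply/eqP; rewrite eqEcard sBA cB leqnn.
apply/forall_inP => H /andP[/andP[_ sAH] _].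
by apply/eqP/setIidPr.
Qed.

(** * Paths in a tree, and leaves cut off by a vertex *)

Hypothesis e_tree : tree e.

Lemma steiner_tree_exists W : W != set0 -> exists H, steiner_tree e W H.
Proof.
case: e_tree => e_conn _ W0.
have cT : connector e W (setT, edges e).
  rewrite /connector subsetT andbT; apply/and3P; split.
  - by rewrite /subgraph /= subxx subsetT.
  - by case/set0Pn: W0 => x _; apply/set0Pn; exists x; rewrite inE.
  apply/forall_inP => x _; apply/forall_inP => y _.
  apply: connect_sub (e_conn x y) => u v uv; apply: connect1.
  by rewrite /subgraph_adj /= mem_edges.
have [H cH minH] := arg_minnP (fun H : pregraph V => #|H.2|) cT.
exists H; rewrite /steiner_tree cH /= eqn_leq steiner_distance_le // andbT.
rewrite /steiner_distance; apply: (big_ind (fun n => #|H.2| <= n)) => //.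
(* The default value of the minimum is the edge count of the whole graph, itself a connector. *)
- exact: (minH _ cT).
- by move=> m n mH nH; rewrite leq_min mH.
Qed.

(** A neighbour [z] of [l] further along the path would close a cycle with the segment up to [z], of
    length at least 3 because [z != u]. *)
Lemma acyclic_neighbour l u z s : path e l (u :: s) -> uniq (l :: u :: s) ->
  e l z -> z != u -> z \notin l :: u :: s.
Proof.
case: e_tree => _ e_acyc /= /andP[elu pus] uls elz zu.
rewrite !inE (negPf zu) negb_or; apply/andP; split.
  by apply: contraTneq elz => ->; rewrite e_irr.
apply/negP => zs; case/path.splitP: zs pus uls => p1 p2 pus uls.
have /e_acyc : ucycle e (l :: u :: rcons p1 z); last by rewrite /= size_rcons.
move: pus; rewrite /ucycle /= rcons_path last_rcons elu cat_path.
case/andP=> -> _; rewrite e_sym elz /=.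
have : uniq ((l :: u :: rcons p1 z) ++ p2) by [].
by rewrite cat_uniq => /andP[].
Qed.

(** Otherwise a simple path from [u] to [z] avoiding [a] would close up to a cycle through [a]. *)
Lemma acyclic_del_neighbours a u z : e a u -> e a z ->
  connect (del_vertex a) u z -> u = z.
Proof.
move=> eau eaz /connectP[p0 pp0 zE].
case/shortenP: pp0 zE => p pp up _ zE.
have pe : path e u p by apply: sub_path pp => s t /andP[].
have ap : a \notin u :: p.
  rewrite inE negb_or; apply/andP; split.
    by apply: contraTneq eau => ->; rewrite e_irr.
  apply/negP => /splitPr pE; case: pE pp => p1 p2.
  by rewrite cat_path /= /del_vertex eqxx !andbF.
apply/eqP; apply: contraT; rewrite eq_sym => zu.
have := @acyclic_neighbour a u z p _ _ eaz zu.
rewrite [path _ _ _]/= eau pe cons_uniq ap up => /(_ isT isT).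
by rewrite zE inE mem_last orbT.
Qed.

(** In a tree this says that [a] lies on the path from [l] to [x], ends included. *)
Definition beyond (a x l : V) := (l == a) || ~~ connect (del_vertex a) l x.

(** Walk from [a] away from [x] until a leaf is met; by acyclicity the walk never revisits a vertex,
    so it stops. *)
Lemma leaf_beyond a x : a != x -> exists2 l, l \in leaves e & beyond a x l.
Proof.
case: (e_tree) => e_conn _ ax.
have [u0 eau0 u0x] : exists2 u, e a u & connect (del_vertex a) u x.
  have /connectP[p0 pp0 xE] := e_conn a x.
  case/shortenP: pp0 xE => [[|u p]] /=.
    by move=> _ _ _ xE; rewrite xE eqxx in ax.
  case/andP=> eau pp /andP[ap _] _ ->; exists u => //.
  exact: connect_del.
(* The walk [l :: s] is read backwards, from its current end [l] to [a]. The number [n] bounds the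
   remaining steps: at [n = 0] the walk would have more vertices than [V]. *)
suff ext n l s : #|V| < size (l :: s) + n -> path e l s -> uniq (l :: s) ->
    last l s = a -> beyond a x l ->
    exists2 l, l \in leaves e & beyond a x l.
  by apply: (ext #|V| a [::]); rewrite // /beyond ?eqxx // add1n.
elim: n l s => [|n IHn] l s ltn ps us sa lb.
  move: ltn; rewrite addn0 ltnNge -(card_uniqP us).
  by rewrite max_card.
have [|lL] := boolP (l \in leaves e); first by exists l.
(* The neighbour of [l] not to be taken: the previous vertex of the walk or, at the start [l = a],
   the neighbour [u0] of [a] towards [x]. *)
pose u := head u0 s.
have elu : e l u.
  rewrite /u; case: (s) ps sa => [_ /= -> //|w t /=].
  by case/andP.
have /subsetPn[z] : ~~ ([set y | e l y] \subset [set u]).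
  apply: contra lL; rewrite subset1 inE /degree => /orP[/eqP->|/eqP E].
    by rewrite cards1.
  by have := in_set0 u; rewrite -E inE elu.
rewrite !inE => elz zu.
have zls : z \notin l :: s.
  move: zu; rewrite /u; case: (s) ps us => [|w t] ps us /= zu.
    by rewrite inE; apply: contraTneq elz => ->; rewrite e_irr.
  exact: acyclic_neighbour.
apply: (IHn z (l :: s)); rewrite ?cons_uniq ?zls //.
- by rewrite /= addSnnS.
- by rewrite /= e_sym elz.
have za : z != a by apply: contraNneq zls => ->; rewrite -sa mem_last.
rewrite /beyond (negPf za) /=; apply/negP => zx.
(* At the first step, a [z] on the side of [x] would be [u0]; later, [z] stays in the component of
   [l]. *)
have [la|la] := eqVneq l a.
  have u_u0 : u = u0.
    rewrite /u; case: (s) us sa => //= w t /andP[+ _] E.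
    by rewrite la -E mem_last.
  case/eqP: zu; rewrite u_u0; apply: (@acyclic_del_neighbours a).
  - by rewrite -la.
  - by [].
  - by rewrite (connect_trans zx) // connect_del_sym.
case/orP: lb => [|/negP[]]; first by rewrite (negPf la).
by apply: connect_trans zx; apply: connect1; rewrite /del_vertex elz la za.
Qed.

(* On the path from [l] to [a], either [b] does not occur, or its initial
   segment up to [b] avoids [a]. *)
Lemma beyond_inj a b l : beyond a b l -> beyond b a l -> a = b.
Proof.
case: (e_tree) => e_conn _.
rewrite /beyond; have [->|la] := eqVneq l a.
  by rewrite connect0 orbF => _ /eqP.
have [-> /=|lb /=] := eqVneq l b; first by rewrite connect0.
have /connectP[p0 pp0 aE] := e_conn l a.
case/shortenP: pp0 aE => p pp up _ aE lab lba.
have [bp|bp] := boolP (b \in l :: p); last first.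
  by case/negP: lba; rewrite aE; apply: connect_del.
move: bp; rewrite inE eq_sym (negPf lb) /= => bp.
case/path.splitP: bp pp up aE => p1 p2 pp up aE.
apply/eqP; apply: contraT => ab.
case/negP: lab; rewrite -[b in connect _ _ b](last_rcons l p1 b).
apply: connect_del; last by move: pp; rewrite cat_path => /andP[].
have ap2 : a \in p2.
  rewrite aE last_cat last_rcons; case: p2 aE {pp up}.
    by rewrite cats0 last_rcons => E; rewrite E eqxx in ab.
  by move=> w t _; rewrite /= mem_last.
by move: up; rewrite -cat_cons cat_uniq => /and3P[_ /hasPn/(_ _ ap2)].
Qed.

(** * The upper bound *)

Lemma sgp_same_component k (A : {set V}) a x y : 2 <= k < #|A| ->
    steiner_general_position e k A ->
    a \in A -> x \in A :\ a -> y \in A :\ a ->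
  connect (del_vertex a) x y.
Proof.
case/andP=> k2 kA sgpA aA xA yA.
(* Here [2 <= k] leaves room for [x] and [y], and [k < #|A|] allows [a] to be left out. *)
have [||B [sxyB sBA cB]] := @subset_between _ [set x; y] (A :\ a) k.
- by apply/subsetP => z /set2P[]->.
- rewrite cards2; apply/andP; split; first by case: (x != y); rewrite // ltnW.
  by move: kA; rewrite (cardsD1 a) aA.
have [|H stH] := @steiner_tree_exists B.
  by rewrite -card_gt0 cB (leq_trans _ k2).
move/forallP/(_ B): sgpA; rewrite cB eqxx andbT.
rewrite (subset_trans sBA (subsetDl _ _)) => /forall_inP/(_ _ stH)/eqP HA.
case/andP: stH => /andP[cH /subsetP sBH] _.
apply: (connected_subgraph_avoid cH).
- apply/negP => aH; have : a \in B by rewrite -HA inE aH.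
  by move/(subsetP sBA); rewrite !inE eqxx.
- by apply/sBH/(subsetP sxyB)/set21.
- by apply/sBH/(subsetP sxyB)/set22.
Qed.

Lemma sgp_card_le k (A : {set V}) : 2 <= k < #|A| ->
  steiner_general_position e k A -> #|A| <= #|leaves e|.
Proof.
move=> kA sgpA; have /andP[k2 ltkA] := kA.
(* Stated for every [a] so that a choice function on all of [V] results; outside [A] the witness is
   arbitrary. *)
have leafA a : exists l, a \in A ->
    l \in leaves e /\ {in A :\ a, forall y, beyond a y l}.
  have [aA|] := boolP (a \in A); last by exists a.
  have /card_gt0P[x xA] : 0 < #|A :\ a|.
    by move: ltkA; rewrite (cardsD1 a) aA ltnS; apply: leq_trans; apply: ltnW.
  have [|l lL lx] := @leaf_beyond a x.
    by move: xA; rewrite !inE eq_sym => /andP[].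
  exists l => _; split=> // y yA; case/orP: lx => [|lx].
    by rewrite /beyond => ->.
  (* The leaf was chosen relative to [x] alone; it serves every [y] because deleting [a] leaves [x]
     and [y] in one component. *)
  apply/orP; right; apply: contra lx => /connect_trans; apply.
  exact: (sgp_same_component kA).
have [f fP] := fin_all_exists leafA.
rewrite -(card_in_imset (f := f)) => [|a b aA bA fab].
  by apply/subset_leq_card/subsetP => _ /imsetP[a /fP[? _] ->].
(* A common leaf of distinct [a] and [b] would have [a] on its path to [b] and [b] on its path to
   [a]. *)
apply/eqP; apply: contraT => ab.
have [_ fa] := fP a aA; have [_ fb] := fP b bA.
case/eqP: (ab); apply: (@beyond_inj _ _ (f a)).
- by apply: fa; rewrite !inE eq_sym ab.
- by rewrite fab; apply: fb; rewrite !inE ab.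
Qed.

End Graphs.

Theorem theorem3p1 (V : finType) (e : rel V)
    (e_sym : symmetric e) (e_irr : irreflexive e) (T_tree : tree e)
    (n_ge3 : 3 <= #|V|) (k : nat) (k_range : 2 <= k <= #|V| - 1) :
  (k <= #|leaves e| -> sgp e k = #|leaves e|) /\
  (#|leaves e| < k -> sgp e k = k).
Proof.
case/andP: k_range => k2 kV.
have ub A : steiner_general_position e k A -> #|A| <= maxn k #|leaves e|.
  move=> sgpA; rewrite leq_max; case: leqP => //= ltkA.
  by apply: (sgp_card_le e_sym e_irr T_tree _ sgpA); rewrite k2.
split=> [kL|Lk]; apply/eqP; rewrite eqn_leq; apply/andP; split.
- by apply/bigmax_leqP => A /ub; rewrite (maxn_idPr kL).
- apply: (leq_bigmax_cond (F := fun A : {set V} => #|A|)).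
  by apply: sgp_leaves; rewrite // (leq_trans _ k2).
- by apply/bigmax_leqP => A /ub; rewrite (maxn_idPl (ltnW Lk)).
(* Any [k] vertices form a [k]-Steiner general position set, and [V] has that many. *)
have [||A [_ _ cA]] := @subset_between _ set0 [set: V] k; first exact: sub0set.
  by rewrite cards0 cardsT (leq_trans kV) ?leq_subr.
rewrite -{1}cA; apply: (leq_bigmax_cond (F := fun A : {set V} => #|A|)).
by rewrite -cA; apply: sgp_card_eq.
Qed.
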